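(* Let $p$ be a prime, $1<q<\infty$ and $-1<\alpha<q-1$. Then for any $f\in L^q(|x|_p^{\alpha}dx)$, $$\|T^pf\|_{L^q(|x|_p^{\alpha}dx)}\leq \left(1-\frac1p\right)\left(\frac{1}{1-p^{\frac{\alpha+1}{q}-1}}+\frac{p^{-\frac{\alpha+1}{q}}}{1-p^{-\frac{\alpha+1}{q}}}\right)\|f\|_{L^q(|x|_p^{\alpha}dx)}.$$ Moreover, $$\|T^p\|_{L^q(|x|_p^{\alpha}dx)\rightarrow L^q(|x|_p^{\alpha}dx)}=\left(1-\frac1p\right)\left(\frac{1}{1-p^{\frac{\alpha+1}{q}-1}}+\frac{p^{-\frac{\alpha+1}{q}}}{1-p^{-\frac{\alpha+1}{q}}}\right).$$
   Context: $\mathbb{Q}_p$ is the field of $p$-adic numbers with norm $|\cdot|_p$ normalized by $|p|_p=p^{-1}$, and $\mathbb{Q}_p^*=\mathbb{Q}_p\setminus\{0\}$. $dx$ is the Haar measure on $\mathbb{Q}_p$ normalized so that $\{x:|x|_p\le 1\}$ has measure $1$. The $p$-adic Hardy-Littlewood-Pólya operator is $$T^pf(x)=\int_{\mathbb{Q}_p^*}\frac{f(y)}{\max(|x|_p,|y|_p)}\,dy,\qquad x\in\mathbb{Q}_p.$$ $L^q(|x|_p^\alpha dx)$ is the weighted Lebesgue space on $\mathbb{Q}_p$ with norm $\|f\|_{L^q(|x|_p^\alpha dx)}=\left(\int_{\mathbb{Q}_p}|f(x)|^q|x|_p^\alpha dx\right)^{1/q}$, and $\|\cdot\|_{L^q(|x|_p^{\alpha}dx)\rightarrow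 L^q(|x|_p^{\alpha}dx)}$ denotes the operator norm. *)

(* Defs.v *)
From HB Require Import structures.
From mathcomp Require Import all_boot all_order all_algebra.
From mathcomp Require Import all_classical all_reals all_analysis.
From mathcomp Require Import measurable_realfun.

Set Implicit Arguments.
Unset Strict Implicit.
Unset Printing Implicit Defensive.

Import Order.TTheory GRing.Theory Num.Theory.

Local Open Scope classical_set_scope.
Local Open Scope ring_scope.

(* [p ^ (- v_p x)], where [v_p x = logn p num - logn p den] *)
Definition padic_abs (p : nat) (x : rat) : rat :=
  if x == 0 then 0
  else p%:R ^ ((logn p `|denq x|)%:Z - (logn p `|numq x|)%:Z).

Section RatAbs.
Variables (p : nat) (hp : prime p).
Implicit Types x y : rat.

Let p_gt0 : 0 < p%:R :> rat. Proof. by rewrite ltr0n prime_gt0. Qed.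
Let p_neq0 : p%:R != 0 :> rat. Proof. by rewrite gt_eqF. Qed.

Lemma padic_abs0 : padic_abs p 0 = 0. Proof. by rewrite /padic_abs eqxx. Qed.

Lemma padic_abs_gt0 x : x != 0 -> 0 < padic_abs p x.
Proof. by move=> x0; rewrite /padic_abs (negPf x0) exprz_gt0. Qed.

Lemma padic_abs_ge0 x : 0 <= padic_abs p x.
Proof.
have [->|/padic_abs_gt0/ltW//] := eqVneq x 0; by rewrite padic_abs0.
Qed.

Lemma padic_abs_eq0 x : (padic_abs p x == 0) = (x == 0).
Proof.
by have [->|/padic_abs_gt0/gt_eqF//] := eqVneq x 0; rewrite padic_abs0 eqxx.
Qed.

Lemma padic_abs_frac (a b : int) : a != 0 -> b != 0 ->
  padic_abs p (a%:~R / b%:~R) = p%:R ^ ((logn p `|b|)%:Z - (logn p `|a|)%:Z).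
Proof.
move=> a0 b0; set x : rat := _ / _.
have x0 : x != 0 by rewrite mulf_neq0 ?invr_eq0 ?intr_eq0.
rewrite /padic_abs (negPf x0); congr (_ ^ _).
have E : (`|numq x| * `|b| = `|a| * `|denq x|)%N.
  rewrite -!abszM; congr absz; apply/eqP; rewrite -(@eqr_int rat) !intrM.
  rewrite numqE /x mulrAC mulfVK ?intr_eq0//.
have := congr1 (logn p) E.
rewrite !lognM ?absz_gt0 ?numq_eq0 ?denq_eq0// => /(congr1 Posz).
rewrite !PoszD => E'; apply/eqP.
by rewrite subr_eq addrAC [X in X - _]addrC E' [X in X - _]addrC addrK.
Qed.

Lemma padic_absM x y : padic_abs p (x * y) = padic_abs p x * padic_abs p y.
Proof.
have [->|x0] := eqVneq x 0; first by rewrite mul0r padic_abs0 mul0r.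
have [->|y0] := eqVneq y 0; first by rewrite mulr0 padic_abs0 mulr0.
rewrite -[in LHS](divq_num_den x) -[in LHS](divq_num_den y) mulf_div -!intrM.
rewrite padic_abs_frac ?mulf_neq0 ?numq_eq0 ?denq_eq0//.
rewrite /padic_abs (negPf x0) (negPf y0) -expfzDr//; congr (_ ^ _).
rewrite !abszM !lognM ?absz_gt0 ?numq_eq0 ?denq_eq0// !PoszD.
by rewrite opprD addrACA.
Qed.

Lemma padic_abs1 : padic_abs p 1 = 1.
Proof. by rewrite /padic_abs oner_eq0 (numq_int 1) (denq_int 1) subrr. Qed.

Lemma padic_absN x : padic_abs p (- x) = padic_abs p x.
Proof. by rewrite /padic_abs oppr_eq0 numqN denqN abszN. Qed.

Lemma padic_absB x y : padic_abs p (x - y) = padic_abs p (y - x).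
Proof. by rewrite -padic_absN opprB. Qed.

Lemma padic_absV x : padic_abs p x^-1 = (padic_abs p x)^-1.
Proof.
have [->|x0] := eqVneq x 0; first by rewrite !(invr0, padic_abs0).
apply: (mulfI (x := padic_abs p x)); first by rewrite padic_abs_eq0.
by rewrite -padic_absM !divff ?padic_abs1// padic_abs_eq0.
Qed.

Let logn_absD (a b : int) : a != 0 -> b != 0 -> a + b != 0 ->
  (minn (logn p `|a|) (logn p `|b|) <= logn p `|(a + b)%R|)%N.
Proof.
move=> a0 b0 ab0; rewrite -pfactor_dvdn ?absz_gt0//.
set k := minn _ _.
have ka : (p ^ k %| `|a|)%N by rewrite pfactor_dvdn ?absz_gt0// geq_minl.
have kb : (p ^ k %| `|b|)%N by rewrite pfactor_dvdn ?absz_gt0// geq_minr.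
have D (c : int) : (p ^ k %| `|c|)%N = ((p ^ k)%N%:Z %| c)%Z by [].
by rewrite D rpredD// -D.
Qed.

Lemma padic_absD x y :
  padic_abs p (x + y) <= Num.max (padic_abs p x) (padic_abs p y).
Proof.
have [->|x0] := eqVneq x 0; first by rewrite add0r le_max lexx orbT.
have [->|y0] := eqVneq y 0; first by rewrite addr0 le_max lexx.
have [->|xy0] := eqVneq (x + y) 0; first by rewrite padic_abs0 le_max padic_abs_ge0.
pose d := denq x * denq y; pose a := numq x * denq y; pose b := numq y * denq x.
have d0 : d != 0 by rewrite mulf_neq0 ?denq_eq0.
have a0 : a != 0 by rewrite mulf_neq0 ?denq_eq0 ?numq_eq0.
have b0 : b != 0 by rewrite mulf_neq0 ?denq_eq0 ?numq_eq0.
have xE : x = a%:~R / d%:~R.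
  by rewrite !intrM -mulf_div divff ?intr_eq0 ?denq_eq0// mulr1 divq_num_den.
have yE : y = b%:~R / d%:~R.
  rewrite !intrM [(denq x)%:~R * _]mulrC -mulf_div.
  by rewrite divff ?intr_eq0 ?denq_eq0// mulr1 divq_num_den.
have ab0 : a + b != 0.
  by apply: contraNneq xy0; rewrite xE yE -mulrDl -intrD => ->; rewrite mul0r.
rewrite [in leLHS]xE [in leLHS]yE -mulrDl -intrD padic_abs_frac//.
rewrite xE yE !padic_abs_frac//.
have p1 : 1 <= p%:R :> rat by rewrite ler1n prime_gt0.
have := logn_absD a0 b0 ab0; rewrite geq_min le_max => /orP[h|h]; apply/orP;
  [left|right]; by apply: ler_weXz2l => //; rewrite lerD2l lerN2 lez_nat.
Qed.

Lemma padic_abs_dist_lt x y z e : padic_abs p (x - y) < e ->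
  padic_abs p (y - z) < e -> padic_abs p (x - z) < e.
Proof.
move=> xy yz; rewrite -(subrKA y); apply: le_lt_trans (padic_absD _ _) _.
by rewrite gt_max xy yz.
Qed.

Lemma padic_abs_isosceles x y :
  padic_abs p (x - y) < padic_abs p y -> padic_abs p x = padic_abs p y.
Proof.
move=> h; apply/eqP; rewrite eq_le; apply/andP; split.
  rewrite -{1}(subrK y x); apply: le_trans (padic_absD _ _) _.
  by rewrite ge_max lexx (ltW h).
have := padic_absD (y - x) x; rewrite subrK le_max => /orP[|//].
by rewrite leNgt padic_absB h.
Qed.

End RatAbs.

Definition padic_cauchy (p : nat) (x : nat -> rat) : Prop :=
  forall e : rat, 0 < e -> exists N, forall m n, (N <= m)%N -> (N <= n)%N ->
    padic_abs p (x m - x n) < e.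

Definition padic_null (p : nat) (x : nat -> rat) : Prop :=
  forall e : rat, 0 < e -> exists N, forall n, (N <= n)%N ->
    padic_abs p (x n) < e.

Section CauchySequences.
Variables (p : nat) (hp : prime p).
Implicit Types x y : nat -> rat.

Lemma padic_cauchy_const (a : rat) : padic_cauchy p (fun=> a).
Proof. by move=> e e0; exists 0%N => *; rewrite subrr padic_abs0. Qed.

Lemma padic_cauchyD x y :
  padic_cauchy p x -> padic_cauchy p y -> padic_cauchy p (x + y).
Proof.
move=> cx cy e e0; have [N hN] := cx _ e0; have [M hM] := cy _ e0.
exists (maxn N M) => m n; rewrite !geq_max => /andP[Nm Mm] /andP[Nn Mn].
have -> : (x + y) m - (x + y) n = (x m - x n) + (y m - y n).
  by rewrite addrACA -opprD.
by apply: le_lt_trans (padic_absD hp _ _) _; rewrite gt_max hN ?hM.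
Qed.

Lemma padic_cauchyN x : padic_cauchy p x -> padic_cauchy p (- x).
Proof.
move=> cx e /cx[N hN]; exists N => m n Nm Nn.
have -> : (- x) m - (- x) n = - (x m - x n) by rewrite opprD.
by rewrite padic_absN hN.
Qed.

Lemma padic_cauchy_bounded x : padic_cauchy p x ->
  exists2 M : rat, 0 < M & exists N, forall n, (N <= n)%N -> padic_abs p (x n) < M.
Proof.
move=> /(_ 1 ltr01)[N hN]; exists (padic_abs p (x N) + 1).
  by rewrite ltr_wpDl ?padic_abs_ge0.
exists N => n Nn; rewrite -(subrK (x N) (x n)).
apply: le_lt_trans (padic_absD hp _ _) _; rewrite gt_max ltrDl ltr01 andbT.
by apply: lt_le_trans (hN _ _ Nn (leqnn _)) _; rewrite lerDr padic_abs_ge0.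
Qed.

Lemma padic_nullM x y : padic_cauchy p x -> padic_null p y -> padic_null p (x * y).
Proof.
move=> /padic_cauchy_bounded[M M0 [N hN]] ny e e0.
have [K hK] := ny (e / M) (divr_gt0 e0 M0).
exists (maxn N K) => n; rewrite geq_max => /andP[Nn Kn].
rewrite -[(x * y) n]/(x n * y n) padic_absM//.
have -> : e = M * (e / M) by rewrite mulrC mulfVK// gt_eqF.
by apply: ltr_pM; rewrite ?padic_abs_ge0 ?hN ?hK.
Qed.

Lemma padic_cauchyM x y :
  padic_cauchy p x -> padic_cauchy p y -> padic_cauchy p (x * y).
Proof.
move=> cx cy e e0.
have [M M0 [N hN]] := padic_cauchy_bounded cx.
have [L L0 [K hK]] := padic_cauchy_bounded cy.
have [N' hN'] := cx (e / L) (divr_gt0 e0 L0).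
have [K' hK'] := cy (e / M) (divr_gt0 e0 M0).
exists (maxn (maxn N N') (maxn K K')) => m n; rewrite !geq_max.
move=> /andP[/andP[? ?] /andP[? ?]] /andP[/andP[? ?] /andP[? ?]].
have -> : (x * y) m - (x * y) n = x m * (y m - y n) + (x m - x n) * y n.
  by rewrite mulrBr mulrBl subrKA.
apply: le_lt_trans (padic_absD hp _ _) _; rewrite !padic_absM// gt_max.
have eM : e = M * (e / M) by rewrite mulrC mulfVK// gt_eqF.
have eL : e = (e / L) * L by rewrite mulfVK// gt_eqF.
apply/andP; split; [rewrite eM|rewrite eL];
  by apply: ltr_pM; rewrite ?padic_abs_ge0 ?hN ?hK ?hN' ?hK'.
Qed.

Lemma padic_nullD x y : padic_null p x -> padic_null p y -> padic_null p (x + y).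
Proof.
move=> nx ny e e0; have [N hN] := nx _ e0; have [M hM] := ny _ e0.
exists (maxn N M) => n; rewrite geq_max => /andP[? ?].
by apply: le_lt_trans (padic_absD hp _ _) _; rewrite gt_max hN ?hM.
Qed.

Lemma padic_null_or_cst x : padic_cauchy p x -> padic_null p x \/
  exists2 r : rat, 0 < r & exists N, forall n, (N <= n)%N -> padic_abs p (x n) = r.
Proof.
move=> cx; have [|nx] := pselect (padic_null p x); [by left|right].
have [e [e0 he]] : exists e : rat, 0 < e /\
    forall N, exists2 n, (N <= n)%N & e <= padic_abs p (x n).
  move/existsNP : nx => [e /not_implyP[e0 /forallNP he]]; exists e; split=> // N.
  have /existsNP[n /not_implyP[Nn /negP]] := he N.
  by rewrite -leNgt; exists n.
have [N hN] := cx _ e0; have [n Nn en] := he N.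
exists (padic_abs p (x n)); first exact: lt_le_trans en.
exists N => m Nm; apply: padic_abs_isosceles => //.
exact: lt_le_trans (hN _ _ Nm Nn) en.
Qed.

Lemma padic_cauchyV x : padic_cauchy p x -> ~ padic_null p x ->
  padic_cauchy p (fun n => (x n)^-1) /\
  exists N, forall n, (N <= n)%N -> x n != 0.
Proof.
move=> cx nx; have [//|[r r0 [N hN]]] := padic_null_or_cst cx.
have xn0 n : (N <= n)%N -> x n != 0.
  by move=> Nn; rewrite -(padic_abs_eq0 hp) hN// gt_eqF.
split; last by exists N.
move=> e e0; have [M hM] := cx (e * (r * r)) (mulr_gt0 e0 (mulr_gt0 r0 r0)).
exists (maxn N M) => m n; rewrite !geq_max => /andP[Nm Mm] /andP[Nn Mn].
have -> : (x m)^-1 - (x n)^-1 = (x n - x m) * (x m * x n)^-1.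
  rewrite mulrBl invfM [x n * _]mulrCA divff ?xn0// mulr1.
  by rewrite [x m * _]mulrA divff ?xn0// mul1r.
by rewrite padic_absM// padic_absV// padic_absM// !hN// ltr_pdivrMr ?mulr_gt0// hM.
Qed.

End CauchySequences.

Section CauchyRing.
Variables (p : nat) (hp : prime p).

(* The unused proof argument only serves to let the subring instance below
   recover the primality of [p].                                              *)
Definition padic_cauchy_pred of prime p : {pred nat -> rat} :=
  fun x => `[< padic_cauchy p x >].

Lemma padic_cauchy_predP x :
  reflect (padic_cauchy p x) (x \in padic_cauchy_pred hp).
Proof. exact: asboolP. Qed.

Lemma padic_cauchy_subring_closed : subring_closed (padic_cauchy_pred hp).
Proof.
split; first by apply/padic_cauchy_predP; exact: padic_cauchy_const.
  move=> x y /padic_cauchy_predP cx /padic_cauchy_predP cy.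
  apply/padic_cauchy_predP.
  by apply: padic_cauchyD => //; exact: padic_cauchyN.
move=> x y /padic_cauchy_predP cx /padic_cauchy_predP cy.
by apply/padic_cauchy_predP; exact: padic_cauchyM.
Qed.

HB.instance Definition _ :=
  GRing.isSubringClosed.Build (nat -> rat) (padic_cauchy_pred hp)
    padic_cauchy_subring_closed.

Record cauchy_seq := CauchySeq {
  cauchy_val :> nat -> rat;
  _ : cauchy_val \in padic_cauchy_pred hp }.

HB.instance Definition _ := [isSub for cauchy_val].
HB.instance Definition _ := [Choice of cauchy_seq by <:].
HB.instance Definition _ :=
  [SubChoice_isSubComNzRing of cauchy_seq by <:].

Lemma cauchy_seqP (x : cauchy_seq) : padic_cauchy p x.
Proof. by apply/padic_cauchy_predP; case: x. Qed.

Definition null_pred : {pred cauchy_seq} := fun x => `[< padic_null p x >].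

Lemma null_predP (x : cauchy_seq) : reflect (padic_null p x) (x \in null_pred).
Proof. exact: asboolP. Qed.

Lemma null_idealr_closed : idealr_closed null_pred.
Proof.
split.
- by apply/null_predP => e e0; exists 0%N => n _; rewrite padic_abs0.
- apply/negP => /null_predP /(_ 1 ltr01)[N /(_ N (leqnn N))].
  by rewrite padic_abs1// ltxx.
- move=> a u v /null_predP nu /null_predP nv; apply/null_predP.
  by apply: padic_nullD => //; apply: padic_nullM => //; exact: cauchy_seqP.
Qed.

HB.instance Definition _ := isIdealr.Build cauchy_seq null_pred
  null_idealr_closed.

End CauchyRing.

Arguments null_pred {p} hp _.

Definition rat_lim (u : nat -> rat) (r : rat) : Prop :=
  forall e : rat, 0 < e -> exists N, forall n, (N <= n)%N -> `|u n - r| < e.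

Lemma rat_lim_unique u r s : rat_lim u r -> rat_lim u s -> r = s.
Proof.
move=> ur us; apply/eqP; rewrite -subr_eq0 -normr_eq0 eq_le normr_ge0 andbT.
apply/ler_addgt0Pr => e e0; rewrite add0r.
have e20 : 0 < e / 2 by rewrite divr_gt0.
have [N hN] := ur _ e20; have [M hM] := us _ e20.
have := hN (maxn N M) (leq_maxl _ _); have := hM (maxn N M) (leq_maxr _ _).
set a := u _ => h1 h2; rewrite -(subrKA a); apply: le_trans (ler_normD _ _) _.
by rewrite (splitr e) lerD// ltW// distrC.
Qed.

Lemma rat_lim_cst u r : (exists N, forall n, (N <= n)%N -> u n = r) ->
  rat_lim u r.
Proof.
by move=> [N hN] e e0; exists N => n Nn; rewrite hN// subrr normr0.
Qed.

Section PadicNumbers.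
Variables (p : nat) (hp : prime p).
Local Open Scope quotient_scope.

Definition Qp := {ideal_quot (null_pred hp)}.

HB.instance Definition _ := GRing.ComNzRing.on Qp.
HB.instance Definition _ : EqQuotient _ _ Qp := EqQuotient.on Qp.
HB.instance Definition _ := isPointed.Build Qp 0.

Implicit Types (u v : cauchy_seq hp) (x y : Qp).

Lemma Qp_eqE u v : (\pi_Qp u == \pi_Qp v) = (u - v \in null_pred hp).
Proof. by rewrite Quotient.idealrBE. Qed.

Lemma Qp_eq0 u : (\pi_Qp u == 0) = (u \in null_pred hp).
Proof. by rewrite -[0](rmorph0 \pi_Qp) Qp_eqE subr0. Qed.

Definition Qp_inv x : Qp := xget 0 [set y | y * x = 1].

Lemma Qp_mulVf x : x != 0 -> Qp_inv x * x = 1.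
Proof.
move=> x0; suff [y yx] : exists y : Qp, y * x = 1.
  by rewrite /Qp_inv; case: xgetP => [_ -> //|/(_ y)].
move: x0; rewrite -[x]reprK; set u := repr x; rewrite Qp_eq0 => /null_predP nu.
have [cv [N hN]] := padic_cauchyV hp (cauchy_seqP u) nu.
pose v := CauchySeq (introT (padic_cauchy_predP hp _) cv).
exists (\pi_Qp v); rewrite -rmorphM -[1](rmorph1 \pi_Qp); apply/eqP.
rewrite Qp_eqE; apply/null_predP => e e0; exists N => n Nn.
have -> : (v * u - 1 : cauchy_seq hp) n = (u n)^-1 * u n - 1 by [].
by rewrite mulVf ?hN// subrr padic_abs0.
Qed.

Lemma Qp_inv0 : Qp_inv 0 = 0.
Proof.
rewrite /Qp_inv; case: xgetP => // y _ /=; rewrite mulr0 => /esym/eqP.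
by rewrite oner_eq0.
Qed.

HB.instance Definition _ := GRing.ComNzRing_isField.Build Qp Qp_mulVf Qp_inv0.

(* For a Cauchy sequence [u] the limit of [padic_abs p (u n)] exists and is
   rational, because a sequence that is not null has an eventually constant
   absolute value.                                                            *)
Definition padic_norm x : rat :=
  xget 0 [set r | rat_lim (fun n => padic_abs p (repr x n)) r].

Lemma padic_norm_lim u : rat_lim (fun n => padic_abs p (u n)) (padic_norm (\pi_Qp u)).
Proof.
have limE v r : rat_lim (fun n => padic_abs p (v n)) r ->
    padic_null p v /\ r = 0 \/
    0 < r /\ exists N, forall n, (N <= n)%N -> padic_abs p (v n) = r.
  move=> vr; have [nv|[s s0 hs]] := padic_null_or_cst hp (cauchy_seqP v).
    left; split=> //; apply: rat_lim_unique vr _ => e /nv[N hN]; exists N => n Nn.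
    by rewrite subr0 ger0_norm ?padic_abs_ge0 ?hN.
  by right; rewrite -(rat_lim_unique (rat_lim_cst hs) vr).
have ex v : exists r, rat_lim (fun n => padic_abs p (v n)) r.
  have [nv|[s s0 hs]] := padic_null_or_cst hp (cauchy_seqP v).
    exists 0 => e /nv[N hN]; exists N => n Nn.
    by rewrite subr0 ger0_norm ?padic_abs_ge0 ?hN.
  by exists s; exact: rat_lim_cst.
rewrite /padic_norm; set w := repr _.
have /null_predP nuw : u - w \in null_pred hp by rewrite -Qp_eqE /w reprK.
case: xgetP => [r _ /= /limE [[nw ->]|[r0 [N hN]]]|nr]; last first.
- by have [r rw] := ex w; case: (nr r).
- have [M hM] := nuw _ r0; apply: rat_lim_cst; exists (maxn N M) => n.
  rewrite geq_max => /andP[Nn Mn]; rewrite -(hN _ Nn).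
  by apply: padic_abs_isosceles => //; rewrite (hN _ Nn); exact: hM.
- have nu := padic_nullD hp nuw nw; move=> e /nu[N hN]; exists N => n Nn.
  have := hN n Nn.
  have -> : (((u - w : cauchy_seq hp) : nat -> rat) + w) n = u n - w n + w n by [].
  by rewrite subrK subr0 ger0_norm ?padic_abs_ge0.
Qed.

Lemma padic_norm_eq u r :
  rat_lim (fun n => padic_abs p (u n)) r -> padic_norm (\pi_Qp u) = r.
Proof. exact: rat_lim_unique (padic_norm_lim u). Qed.

Lemma padic_norm_ge0 x : 0 <= padic_norm x.
Proof.
rewrite -[x]reprK; apply/ler_addgt0Pr => e e0.
have [N /(_ N (leqnn N))] := padic_norm_lim (repr x) e0.
rewrite ltr_distl => /andP[_ h].
by apply: le_trans (ltW h); rewrite padic_abs_ge0.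
Qed.

Lemma padic_norm0 : padic_norm 0 = 0.
Proof.
rewrite -(rmorph0 \pi_Qp); apply: padic_norm_eq; apply: rat_lim_cst.
by exists 0%N => n _; rewrite padic_abs0.
Qed.

Lemma padic_norm_eq0 x : (padic_norm x == 0) = (x == 0).
Proof.
apply/eqP/eqP => [|->]; last exact: padic_norm0.
rewrite -[x]reprK => x0; apply/eqP; rewrite Qp_eq0; apply/null_predP => e e0.
have := padic_norm_lim (repr x) e0; rewrite x0 => -[N hN]; exists N => n /hN.
by rewrite subr0 ger0_norm ?padic_abs_ge0.
Qed.

Lemma padic_normN x : padic_norm (- x) = padic_norm x.
Proof.
rewrite -[x]reprK -rmorphN; apply: padic_norm_eq => e e0.
have [N hN] := padic_norm_lim (repr x) e0; exists N => n /hN.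
by rewrite -[(- repr x : cauchy_seq hp) n]/(- repr x n) padic_absN.
Qed.

Lemma padic_normD x y :
  padic_norm (x + y) <= Num.max (padic_norm x) (padic_norm y).
Proof.
rewrite -[x]reprK -[y]reprK -rmorphD; set u := repr x; set v := repr y.
apply/ler_addgt0Pr => e e0; have e20 : 0 < e / 2 by rewrite divr_gt0.
have [N hN] := padic_norm_lim u e20; have [M hM] := padic_norm_lim v e20.
have [K hK] := padic_norm_lim (u + v) e20.
pose n := maxn N (maxn M K).
have /hN : (N <= n)%N by rewrite leq_maxl.
have /hM : (M <= n)%N by rewrite /n maxnCA leq_maxl.
have /hK : (K <= n)%N by rewrite /n maxnA leq_maxr.
rewrite ltr_distlC => /andP[_ /ltW h1].
rewrite ltr_distl => /andP[_ /ltW h2]; rewrite ltr_distl => /andP[_ /ltW h3].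
rewrite (splitr e) addrA; apply: le_trans h1 _; rewrite lerD2r.
apply: le_trans (padic_absD hp (u n) (v n)) _.
by rewrite addr_maxl ge_max !le_max h2 h3 orbT.
Qed.

Lemma padic_norm_neq0 x : x != 0 ->
  exists N, forall n, (N <= n)%N -> padic_abs p (repr x n) = padic_norm x.
Proof.
rewrite -{1}[x]reprK Qp_eq0 => /null_predP nx.
have [//|[r _ hr]] := padic_null_or_cst hp (cauchy_seqP (repr x)).
by rewrite -[in padic_norm x](reprK x) (padic_norm_eq (rat_lim_cst hr)).
Qed.

Lemma padic_normM x y : padic_norm (x * y) = padic_norm x * padic_norm y.
Proof.
have [->|x0] := eqVneq x 0; first by rewrite mul0r padic_norm0 mul0r.
have [->|y0] := eqVneq y 0; first by rewrite mulr0 padic_norm0 mulr0.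
rewrite -[in LHS](reprK x) -[in LHS](reprK y) -rmorphM; apply: padic_norm_eq.
have [[N hN] [M hM]] := (padic_norm_neq0 x0, padic_norm_neq0 y0).
apply: rat_lim_cst; exists (maxn N M) => n; rewrite geq_max => /andP[Nn Mn].
by rewrite -(hN n Nn) -(hM n Mn) -padic_absM.
Qed.

Definition cauchy_cst (a : rat) : cauchy_seq hp :=
  CauchySeq (introT (padic_cauchy_predP hp _) (padic_cauchy_const p a)).

Lemma Qp_ratr (a : rat) : ratr a = \pi_Qp (cauchy_cst a).
Proof.
pose f (b : rat) : Qp := \pi_Qp (cauchy_cst b).
have fB : zmod_morphism f.
  by move=> b c; rewrite /f -rmorphB; congr \pi_Qp; exact/val_inj.
have fM : monoid_morphism f.
  split; first by rewrite /f -(rmorph1 \pi_Qp); congr \pi_Qp; exact/val_inj.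
  by move=> b c; rewrite /f -rmorphM; congr \pi_Qp; exact/val_inj.
pose fZ := GRing.isZmodMorphism.Build _ _ f fB.
pose fR := GRing.isMonoidMorphism.Build _ _ f fM.
pose F : {rmorphism rat -> Qp} := HB.pack f fZ fR.
by rewrite -(fmorph_eq_rat F).
Qed.

Lemma Qp_ratrB (a b : rat) : ratr (a - b) = ratr a - ratr b :> Qp.
Proof. by rewrite !Qp_ratr -rmorphB; congr \pi_Qp; exact/val_inj. Qed.

Lemma padic_norm_rat (a : rat) : padic_norm (ratr a) = padic_abs p a.
Proof.
by rewrite Qp_ratr; apply: padic_norm_eq; apply: rat_lim_cst; exists 0%N.
Qed.

Lemma padic_dense x (e : rat) : 0 < e ->
  exists a : rat, padic_norm (x - ratr a) < e.
Proof.
move=> e0; have e20 : 0 < e / 2 by rewrite divr_gt0.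
rewrite -[x]reprK; set u := repr x.
have [N hN] := cauchy_seqP u e20; exists (u N).
rewrite Qp_ratr -rmorphB (splitr e).
have [M hM] := padic_norm_lim (u - cauchy_cst (u N)) e20.
have := hM (maxn N M) (leq_maxr _ _); rewrite ltr_distlC => /andP[_ /lt_trans].
by apply; rewrite ltrD2r; apply: hN; rewrite ?leq_maxl.
Qed.

Lemma padic_complete (u : nat -> Qp) :
  (forall e, 0 < e -> exists N, forall m n, (N <= m)%N -> (N <= n)%N ->
     padic_norm (u m - u n) < e) ->
  exists x, forall e, 0 < e -> exists N, forall n, (N <= n)%N ->
     padic_norm (u n - x) < e.
Proof.
move=> cu.
have n0 (n : nat) : 0 < n.+1%:R^-1 :> rat by rewrite invr_gt0 ltr0n.
have [a ha] := choice (fun n => padic_dense (u n) (n0 n)).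
have small (e : rat) : 0 < e -> exists N, forall n, (N <= n)%N ->
    padic_norm (u n - ratr (a n)) < e.
  move=> e0; exists (Num.truncn e^-1) => n Nn; apply: lt_trans (ha n) _.
  rewrite invf_plt ?posrE ?ltr0n//.
  by apply: lt_le_trans (truncnS_gt _) _; rewrite ler_nat ltnS.
have ca : padic_cauchy p a.
  move=> e e0; have [N hN] := cu _ e0; have [M hM] := small _ e0.
  exists (maxn N M) => m n; rewrite !geq_max => /andP[Nm Mm] /andP[Nn Mn].
  rewrite -padic_norm_rat Qp_ratrB -(subrKA (u m)) -(subrKA (u n) (u m)).
  apply: le_lt_trans (padic_normD _ _) _; rewrite gt_max -padic_normN opprB hM//=.
  apply: le_lt_trans (padic_normD _ _) _; rewrite gt_max hN//=.
  exact: hM.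
pose v := CauchySeq (introT (padic_cauchy_predP hp _) ca).
exists (\pi_Qp v) => e e0; have e20 : 0 < e / 2 by rewrite divr_gt0.
have [N hN] := small _ e0; have [M hM] := ca _ e20.
exists (maxn N M) => n; rewrite geq_max => /andP[Nn Mn].
rewrite -(subrKA (ratr (a n))); apply: le_lt_trans (padic_normD _ _) _.
rewrite gt_max hN//= Qp_ratr -rmorphB (splitr e).
have [K hK] := padic_norm_lim (cauchy_cst (a n) - v) e20.
have := hK (maxn M K) (leq_maxr _ _); rewrite ltr_distlC => /andP[_ /lt_trans].
by apply; rewrite ltrD2r; apply: hM; rewrite ?leq_maxl.
Qed.

Let dist x y : rat := padic_norm (x - y).
Let distxx x : dist x x = 0. Proof. by rewrite /dist subrr padic_norm0. Qed.
Let dist_eq x y : dist x y = 0 -> x = y.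
Proof. by move/eqP; rewrite padic_norm_eq0 subr_eq0 => /eqP. Qed.
Let dist_sym x y : dist x y = dist y x.
Proof. by rewrite /dist -padic_normN opprB. Qed.
Let dist_triangle y x z : dist x z <= dist x y + dist y z.
Proof.
rewrite /dist -(subrKA y); apply: le_trans (padic_normD _ _) _.
by rewrite ge_max lerDl lerDr !padic_norm_ge0.
Qed.

HB.instance Definition _ :=
  isMetric.Build rat Qp distxx dist_eq dist_sym dist_triangle.

End PadicNumbers.

HB.instance Definition _ (p : nat) (hp : prime p) :=
  Measurable.copy (Qp hp) (g_sigma_algebraType (@open (Qp hp))).

Section HardyLittlewoodPolya.
Local Open Scope ereal_scope.
Context (R : realType) (p : nat) (hp : prime p).
Variable mu : {measure set (Qp hp) -> \bar R}.

(* On the Borel sets of [Qp hp] these two conditions determine [mu]; local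
   finiteness and regularity follow from them.                                *)
Definition padic_haar : Prop :=
  (forall (a : Qp hp) (A : set (Qp hp)),
     measurable A -> mu [set (a + x)%R | x in A] = mu A) /\
  mu [set x : Qp hp | (padic_norm x <= 1)%R] = 1.

(* Values are taken in [\bar R] so that points where the integral diverges
   are not silently assigned a finite value.                                  *)
Definition padic_hlp (f : Qp hp -> R) (x : Qp hp) : \bar R :=
  \int[mu]_(y in [set y : Qp hp | y != 0%R])
    (f y / Num.max (ratr (padic_norm x)) (ratr (padic_norm y)))%:E.

(* The value of the weight at the null point [x = 0] is immaterial.           *)
Definition padic_Lq_norm (q alpha : R) (g : Qp hp -> \bar R) : \bar R :=
  (\int[mu]_x (`|g x| `^ q * (ratr (padic_norm x) `^ alpha)%:E)) `^ q^-1.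

Definition padic_Lq (q alpha : R) (g : Qp hp -> \bar R) : Prop :=
  measurable_fun setT g /\ padic_Lq_norm q alpha g < +oo.

Definition padic_Lq_opnorm (q alpha : R)
    (T : (Qp hp -> R) -> Qp hp -> \bar R) : \bar R :=
  ereal_sup [set padic_Lq_norm q alpha (T f) | f in
    [set f : Qp hp -> R | padic_Lq q alpha (EFin \o f) /\
                          padic_Lq_norm q alpha (EFin \o f) <= 1]].

End HardyLittlewoodPolya.

(* Main.v *)
Require Import Defs.
From HB Require Import structures.
From mathcomp Require Import all_boot all_order all_algebra.
From mathcomp Require Import all_classical all_reals all_analysis.
From mathcomp Require Import measurable_realfun.
From mathcomp Require Import ring lra zify.

(* Write s = (alpha + 1) / q, which lies in (0, 1), N x = |x|_p and
   K(x, y) = 1 / max(N x, N y).  Summing over the spheres N y = p^k, whose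
   measure is p^k (1 - 1/p), gives two geometric series and
     \int K(x, y) N(y)^(-s) dy = C N(x)^(-s)          for x <> 0,
   and C is unchanged under s |-> 1 - s.  This is the input of a Schur test:
   Hoelder's inequality with weights N^(+- s (q - 1) / q) and then Tonelli's
   theorem bound the norm by C.  For the converse, N^(-s) cut off to
   1 <= N < p^n has norm^q equal to n (1 - 1/p), and on the spheres
   N = p^j with m <= j < n - m its image is at least C_m N^(-s), where C_m sums
   the first m terms of both series.  Hence ||T||^q >= C_m^q (n - 2 m) / n; let
   n, then m, tend to infinity. *)

Set Implicit Arguments.
Unset Strict Implicit.
Unset Printing Implicit Defensive.

Import Order.TTheory GRing.Theory Num.Theory.
Import numFieldNormedType.Exports.

Local Open Scope classical_set_scope.
Local Open Scope ring_scope.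

Section PadicTopology.
Context (p : nat) (hp : prime p).
Implicit Types x y : Qp hp.

Let p_gt1 : 1 < p%:R :> rat. Proof. by rewrite ltr1n prime_gt1. Qed.
Let p_gt0 : 0 < p%:R :> rat. Proof. exact: lt_trans p_gt1. Qed.

Lemma padic_norm_gt0 x : (0 < padic_norm x) = (x != 0).
Proof. by rewrite lt_def padic_norm_eq0 padic_norm_ge0 andbT. Qed.

Lemma padic_norm_pow x : x != 0 -> exists k : int, padic_norm x = p%:R ^ k.
Proof.
move=> x0; have := x0; rewrite -padic_norm_gt0.
have [N /(_ N (leqnn N)) <-] := padic_norm_neq0 x0.
by rewrite /padic_abs; case: eqP => [_|_ _]; [rewrite ltxx|eexists].
Qed.

Lemma padic_norm_isosceles x y :
  padic_norm (x - y) < padic_norm y -> padic_norm x = padic_norm y.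
Proof.
move=> h; apply/eqP; rewrite eq_le; apply/andP; split.
  rewrite -{1}(subrK y x); apply: le_trans (padic_normD _ _) _.
  by rewrite ge_max lexx (ltW h).
have := padic_normD (y - x) x; rewrite subrK le_max => /orP[|//].
by rewrite leNgt -padic_normN opprB h.
Qed.

Lemma padic_norm1 : padic_norm (1 : Qp hp) = 1.
Proof.
by rewrite -[1](rmorph1 (\pi_(Qp hp)%qT)) (padic_norm_eq (r := 1))//;
  apply: rat_lim_cst; exists 0%N => n _; rewrite -[RHS](padic_abs1 p).
Qed.

Lemma padic_normV x : padic_norm x^-1 = (padic_norm x)^-1.
Proof.
have [->|x0] := eqVneq x 0; first by rewrite !(invr0, padic_norm0).
apply: (mulfI (x := padic_norm x)); first by rewrite padic_norm_eq0.
by rewrite -padic_normM !divff ?padic_norm1// padic_norm_eq0.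
Qed.

Lemma padic_norm_p : padic_norm (p%:R : Qp hp) = p%:R^-1.
Proof.
have -> : p%:R = ratr p%:~R :> Qp hp by rewrite ratr_int.
rewrite padic_norm_rat /padic_abs intr_eq0 eqz_nat -[_ == 0%N]negbK.
rewrite -lt0n prime_gt0//= numq_int denq_int absz1 absz_nat logn1.
by rewrite -[p in logn p p]expn1 pfactorK.
Qed.

Lemma padic_norm_pexpz (k : int) : padic_norm (p%:R ^ k : Qp hp) = p%:R ^ (- k).
Proof.
have Xn n : padic_norm (p%:R ^+ n : Qp hp) = p%:R ^- n.
  elim: n => [|n IH]; first by rewrite !expr0 padic_norm1 invr1.
  by rewrite !exprS padic_normM IH padic_norm_p invfM.
case: k => n; first by rewrite -exprnP Xn exprnN.
by rewrite NegzE opprK -exprnN padic_normV Xn invrK.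
Qed.

Lemma open_radial (A : set (Qp hp)) :
  ~ A 0 -> (forall x y, padic_norm x = padic_norm y -> A x -> A y) -> open A.
Proof.
move=> A0 Ar; rewrite openE => x Ax; apply/(@nbhs_ballP rat (Qp hp)).
have x0 : x != 0 by apply: contra_notN A0 => /eqP <-.
exists (padic_norm x); first by rewrite /= padic_norm_gt0.
move=> y; rewrite ballEmdist /= /mdist/= => xy; apply: Ar Ax; apply/esym.
by apply: padic_norm_isosceles; rewrite -padic_normN opprB.
Qed.

Lemma Qp_open_measurable (A : set (Qp hp)) : open A -> measurable A.
Proof. exact: sub_sigma_algebra. Qed.

Lemma measurable_set1_0 : measurable [set 0 : Qp hp].
Proof.
rewrite -[X in measurable X]setCK; apply: measurableC; apply: Qp_open_measurable.
apply: open_radial => [/=|x y xy /eqP]; first by move=> /(_ erefl).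
by rewrite -padic_norm_eq0 xy padic_norm_eq0 => /eqP.
Qed.

Lemma measurable_radial (A : set (Qp hp)) :
  (forall x y, padic_norm x = padic_norm y -> A x -> A y) -> measurable A.
Proof.
move=> Ar.
have mA : measurable (A `\ 0).
  apply: Qp_open_measurable; apply: open_radial => [[_ /(_ erefl)]//|x y xy [Ax x0]].
  split; first exact: Ar Ax.
  by move/eqP: x0; rewrite -padic_norm_eq0 xy padic_norm_eq0 => /eqP.
have [A0|A0] := pselect (A 0).
  by rewrite -(setD1K A0); apply: measurableU => //; exact: measurable_set1_0.
by rewrite -(not_setD1 A0).
Qed.

Lemma measurable_fun_radial d (T : measurableType d) (g : Qp hp -> T)
    (D : set (Qp hp)) :
  (forall x y, padic_norm x = padic_norm y -> g x = g y) -> measurable_fun D g.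
Proof.
move=> gr mD Y mY; apply: measurableI => //.
by apply: measurable_radial => x y xy /=; rewrite (gr x y).
Qed.

Definition pball (k : int) : set (Qp hp) :=
  [set x | padic_norm x <= p%:R ^ k].
Definition psphere (k : int) : set (Qp hp) :=
  [set x | padic_norm x = p%:R ^ k].

Lemma measurable_pball k : measurable (pball k).
Proof. by apply: measurable_radial => x y; rewrite /pball/= => ->. Qed.

Lemma measurable_psphere k : measurable (psphere k).
Proof. by apply: measurable_radial => x y; rewrite /psphere/= => ->. Qed.

Lemma pball_lt k x : padic_norm x < p%:R ^ (k + 1) -> pball k x.
Proof.
have [->|x0] := eqVneq x 0; first by rewrite /pball/= padic_norm0 exprz_ge0// ltW.
have [j xj] := padic_norm_pow x0; rewrite /pball/= xj ltr_eXz2l// ler_eXz2l//.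
by rewrite ltzD1.
Qed.

Lemma psphere_pballD k : psphere k = pball k `\` pball (k - 1).
Proof.
apply/seteqP; split=> x; rewrite /psphere/pball/=.
  by move=> ->; rewrite lexx ler_eXz2l//; split => //; lia.
move=> [xk /negP]; rewrite -ltNge => kx; apply/eqP; rewrite eq_le xk.
rewrite leNgt; apply/negP => /= h; have := @pball_lt (k - 1) x.
by rewrite subrK => /(_ h); rewrite /pball/= leNgt kx.
Qed.

Lemma padic_residue x : padic_norm x <= 1 ->
  exists i : 'I_p, padic_norm (x - (i%:R)) < 1.
Proof.
move=> x1; have [a xa] := padic_dense x (@ltr01 rat).
have a1 : padic_abs p a <= 1.
  rewrite -(padic_norm_rat hp) -[ratr a](subrK x) -[_ - x]opprB.
  by apply: le_trans (padic_normD _ _) _; rewrite ge_max padic_normN (ltW xa).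
have pd : ~~ (p %| `|denq a|)%N.
  have [->|a0] := eqVneq a 0; first by rewrite dvdn1 gtn_eqF// prime_gt1.
  apply/negP => pd; move: a1; rewrite /padic_abs (negPf a0).
  rewrite -[X in _ <= X](expr0z (p%:R : rat)) ler_eXz2l// subr_le0 lez_nat.
  have := pfactor_dvdn 1 hp (m := `|denq a|); rewrite absz_gt0 denq_eq0 => /(_ isT).
  rewrite expn1 pd => /esym d1 d2.
  have := pfactor_dvdn 1 hp (m := `|numq a|); rewrite absz_gt0 numq_eq0 a0.
  move=> /(_ isT); rewrite (leq_trans d1 d2) expn1 => pn.
  have := coprime_num_den a; rewrite /coprime => /eqP cop.
  have : (p %| gcdn `|numq a| `|denq a|)%N by rewrite dvdn_gcd pn pd.
  by rewrite cop dvdn1 gtn_eqF// prime_gt1.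
have cpd : coprimez p (denq a) by rewrite coprimezE /= prime_coprime.
(* [v] inverts [denq a] modulo [p]. *)
have [u [v uv]] := Bezoutz p (denq a).
rewrite (eqP cpd) in uv.
pose j := (v * numq a %% p)%Z.
have p0 : (p%:Z != 0) by rewrite eqz_nat -lt0n prime_gt0.
have j0 : 0 <= j by rewrite modz_ge0.
have jp : (`|j| < p)%N by rewrite -ltz_nat gez0_abs// ltz_pmod// ltz_nat prime_gt0.
exists (Ordinal jp) => /=.
have -> : `|j|%:R = ratr j%:~R :> Qp hp.
  by rewrite ratr_int -{2}(gez0_abs j0).
rewrite -(subrKA (ratr a)); apply: le_lt_trans (padic_normD _ _) _.
rewrite gt_max xa/= -Qp_ratrB padic_norm_rat.
have [->|aj] := eqVneq (a - j%:~R) 0; first by rewrite padic_abs0.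
have E : a - j%:~R = (numq a - j * denq a)%:~R / (denq a)%:~R.
  by rewrite intrB intrM mulrBl divq_num_den mulfK// intr_eq0 denq_eq0.
have n0 : numq a - j * denq a != 0.
  by apply: contraNneq aj; rewrite E => ->; rewrite mul0r.
rewrite E padic_abs_frac ?denq_eq0//.
rewrite -[X in _ < X](expr0z (p%:R : rat)) ltr_eXz2l// subr_lt0 ltz_nat.
have -> : logn p `|denq a| = 0%N by rewrite lognE (negPf pd) !andbF.
rewrite -pfactor_dvdn ?absz_gt0// expn1.
have -> : numq a - j * denq a =
    (u * numq a + (v * numq a %/ p)%Z * denq a) * p.
  have nE : numq a = (u * p + v * denq a) * numq a by rewrite uv mul1r.
  have jE : j = v * numq a - (v * numq a %/ p)%Z * p.
    by rewrite {1}(divz_eq (v * numq a) p) addrAC subrr add0r.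
  by rewrite jE {1}nE; ring.
by rewrite abszM dvdn_mull.
Qed.

End PadicTopology.

Arguments pball {p} hp k _.
Arguments psphere {p} hp k _.

Section PadicBalls.
Context (p : nat) (hp : prime p).
Implicit Types x y a : Qp hp.

Let p_gt1 : 1 < p%:R :> rat. Proof. by rewrite ltr1n prime_gt1. Qed.
Let p_gt0 : 0 < p%:R :> rat. Proof. exact: lt_trans p_gt1. Qed.

Lemma padic_norm_nat_le1 n : padic_norm (n%:R : Qp hp) <= 1.
Proof.
elim: n => [|n IH]; first by rewrite padic_norm0.
rewrite -addn1 natrD; apply: le_trans (padic_normD _ _) _.
by rewrite ge_max IH padic_norm1 lexx.
Qed.

Lemma padic_norm_nat_lt1 n : padic_norm (n%:R : Qp hp) < 1 -> (p %| n)%N.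
Proof.
have [->|n0] := eqVneq n 0%N; first by rewrite dvdn0.
have -> : n%:R = ratr n%:~R :> Qp hp by rewrite ratr_int.
rewrite padic_norm_rat /padic_abs intr_eq0 eqz_nat (negPf n0).
rewrite numq_int denq_int absz1 absz_nat logn1 -[X in _ < X](expr0z (p%:R : rat)).
by rewrite ltr_eXz2l// subr_lt0 ltz_nat logn_gt0 mem_primes => /and3P[].
Qed.

Lemma translate_pball a k :
  [set a + x | x in pball hp k] = [set y | pball hp k (y - a)].
Proof.
apply/seteqP; split => y /= => [[x xk <-]|ya]; first by rewrite addrAC subrr add0r.
by exists (y - a) => //; rewrite addrCA subrr addr0.
Qed.

Lemma measurable_translate_pball a k : measurable [set a + x | x in pball hp k].
Proof.
apply: Qp_open_measurable; rewrite translate_pball openE => x xk.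
apply/(@nbhs_ballP rat (Qp hp)); exists (p%:R ^ k); first by rewrite /= exprz_gt0.
move=> y; rewrite ballEmdist /= /mdist/= => xy; rewrite /pball/= -(subrKA x).
apply: le_trans (padic_normD _ _) _; rewrite ge_max; apply/andP; split => //.
by rewrite -padic_normN opprB ltW.
Qed.

Let translate k (i : nat) : set (Qp hp) :=
  [set i%:R * p%:R ^ (- (k + 1)) + x | x in pball hp k].

Let pQ0 : p%:R != 0 :> Qp hp.
Proof. by rewrite -padic_norm_eq0 padic_norm_p invr_eq0 gt_eqF. Qed.

Lemma pball_translates k :
  pball hp (k + 1) = \big[setU/set0]_(i < p) translate k i.
Proof.
rewrite -bigcup_mkord; apply/seteqP; split => y.
  rewrite /pball/= => yk.
  have : padic_norm (y * p%:R ^ (k + 1)) <= 1.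
    rewrite padic_normM padic_norm_pexpz -invr_expz ler_pdivrMr ?exprz_gt0//.
    by rewrite mul1r.
  move=> /padic_residue[i yi]; exists (val i); first exact: ltn_ord.
  rewrite /translate translate_pball/=; apply: pball_lt.
  have -> : y - i%:R * p%:R ^ (- (k + 1)) =
      (y * p%:R ^ (k + 1) - i%:R) * p%:R ^ (- (k + 1)).
    by rewrite mulrBl -[y * _ * _]mulrA -expfzDr// subrr expr0z mulr1.
  rewrite padic_normM padic_norm_pexpz opprK -[X in _ < X]mul1r ltr_pM2r//.
  exact: exprz_gt0.
move=> [i ip]; rewrite /translate => -[x xk <-]; rewrite /pball/=.
apply: le_trans (padic_normD _ _) _; rewrite ge_max padic_normM padic_norm_pexpz.
rewrite opprK ler_piMl ?exprz_ge0 ?padic_norm_nat_le1 ?(ltW p_gt0)//=.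
by apply: le_trans xk _; rewrite ler_eXz2l//; lia.
Qed.

Lemma trivIset_translate k : trivIset setT (fun i : 'I_p => translate k i).
Proof.
suff H (i j : 'I_p) y : (i < j)%N -> translate k i y -> translate k j y -> False.
  apply/trivIsetP => i j _ _ ij; rewrite -subset0 => y [yi yj].
  by have [/H/(_ yi yj)|/H/(_ yj yi)|/ord_inj/eqP] := ltngtP i j; rewrite ?(negPf ij).
move=> ij; rewrite /translate !translate_pball /pball /= => yi yj.
have : padic_norm ((j - i)%:R : Qp hp) < 1.
  have -> : (j - i)%:R = ((y - i%:R * p%:R ^ (- (k + 1))) -
      (y - j%:R * p%:R ^ (- (k + 1)))) * p%:R ^ (k + 1) :> Qp hp.
    rewrite opprB addrC subrKA -mulrBl -natrB ?(ltnW ij)//.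
    by rewrite -mulrA -expfzDr// addNr expr0z mulr1.
  rewrite padic_normM padic_norm_pexpz -[X in _ * X]invr_expz.
  rewrite ltr_pdivrMr ?exprz_gt0// mul1r.
  apply: le_lt_trans (padic_normD _ _) _; rewrite padic_normN.
  apply: (@le_lt_trans _ _ (p%:R ^ k)); first by rewrite ge_max yi yj.
  by rewrite ltr_eXz2l// ltrDl.
move=> /padic_norm_nat_lt1 /dvdn_leq; rewrite subn_gt0 ij => /(_ isT).
by have := ltn_ord j; lia.
Qed.

End PadicBalls.

Section HaarBalls.
Context (R : realType) (p : nat) (hp : prime p).
Context (mu : {measure set (Qp hp) -> \bar R}) (hmu : padic_haar mu).

Let P : R := p%:R.
Let P_gt1 : 1 < P. Proof. by rewrite ltr1n prime_gt1. Qed.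
Let P_gt0 : 0 < P. Proof. exact: lt_trans P_gt1. Qed.

Lemma haar_pballS k : mu (pball hp (k + 1)) = (\sum_(i < p) mu (pball hp k))%E.
Proof.
rewrite pball_translates measure_semi_additive_ord//.
- by apply: eq_bigr => i _; apply: hmu.1; exact: measurable_pball.
- by move=> i; exact: measurable_translate_pball.
- exact: trivIset_translate.
- by rewrite -pball_translates; exact: measurable_pball.
Qed.

Lemma haar_pball k : mu (pball hp k) = (P ^ k)%:E.
Proof.
have S r : (\sum_(i < p) r%:E)%E = (P * r)%:E.
  by rewrite sumEFin sumr_const card_ord mulr_natl.
have P0 : P != 0 by rewrite gt_eqF.
have up j : mu (pball hp j) = (P ^ j)%:E -> mu (pball hp (j + 1)) = (P ^ (j + 1))%:E.
  by move=> h; rewrite haar_pballS h S expfzDr// mulrC.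
have down j : mu (pball hp (j + 1)) = (P ^ (j + 1))%:E -> mu (pball hp j) = (P ^ j)%:E.
  move=> h; have fin : mu (pball hp j) \is a fin_num.
    rewrite ge0_fin_numE//; apply: le_lt_trans (ltry (P ^ (j + 1))); rewrite -h.
    apply: le_measure; rewrite ?inE; try exact: measurable_pball.
    move=> x; rewrite /pball/= => /le_trans; apply; rewrite ler_eXz2l ?ltr1n ?prime_gt1//.
    by rewrite lerDl.
  move: h; rewrite haar_pballS -(fineK fin) S => -[]; rewrite expfzDr// [RHS]mulrC.
  by move=> /(mulfI P0) ->.
case: k => n.
  elim: n => [|n IH]; first exact: hmu.2.
  by rewrite -addn1 PoszD; exact: up.
elim: n => [|n IH]; apply: down; first exact: hmu.2.
by have -> : Negz n.+1 + 1 = Negz n by lia.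
Qed.

Lemma haar_psphere k : mu (psphere hp k) = (P ^ k * (1 - P^-1))%:E.
Proof.
have mB := @measurable_pball p hp.
rewrite psphere_pballD (measureD (mB k) (mB (k - 1))); last first.
  by rewrite /= haar_pball ltry.
rewrite /= setIidr; last first.
  move=> x; rewrite /pball/= => /le_trans; apply; rewrite ler_eXz2l ?ltr1n ?prime_gt1//.
  by lia.
by rewrite !haar_pball -EFinB expfzDr ?gt_eqF// mulrBr mulr1 exprN1.
Qed.

Lemma haar_set1_0 : mu [set 0 : Qp hp] = 0%E.
Proof.
apply/eqP; rewrite eq_le measure_ge0 andbT.
have H n : (mu [set (0%R : Qp hp)] <= (n.+1%:R^-1)%:E)%E.
  apply: (@le_trans _ _ (mu (pball hp (- n%:Z)))).
    apply: le_measure; rewrite ?inE; [exact: measurable_set1_0|exact: measurable_pball|].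
    by move=> x ->; rewrite /pball/= padic_norm0 exprz_ge0.
  rewrite haar_pball lee_fin -exprnN lef_pV2 ?posrE ?exprn_gt0//.
  by rewrite -natrX ler_nat ltn_expl// prime_gt1.
apply/lee_addgt0Pr => e e0; rewrite add0e.
apply: le_trans (H (Num.truncn e^-1)) _; rewrite lee_fin invf_ple ?posrE//.
exact/ltW/truncnS_gt.
Qed.

Lemma haar_sigma_finite : sigma_finite setT mu.
Proof.
exists (fun n : nat => pball hp n).
  apply/esym; rewrite -subTset => x _.
  exists (Num.truncn (padic_norm x)) => //; rewrite /pball/=.
  apply: (@le_trans _ _ (Num.truncn (padic_norm x)).+1%:R); first exact/ltW/truncnS_gt.
  by rewrite -exprnP -natrX ler_nat ltn_expl// prime_gt1.
by move=> n; split; [exact: measurable_pball|rewrite haar_pball ltry].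
Qed.

Definition rnorm (x : Qp hp) : R := ratr (padic_norm x).

Lemma rnorm_ge0 x : 0 <= rnorm x.
Proof. by rewrite /rnorm ler0q padic_norm_ge0. Qed.

Lemma rnorm_gt0 x : (0 < rnorm x) = (x != 0).
Proof. by rewrite /rnorm ltr0q padic_norm_gt0. Qed.

Lemma rnorm0 : rnorm 0 = 0.
Proof. by rewrite /rnorm padic_norm0 raddf0. Qed.

Lemma rnorm_psphere k x : psphere hp k x -> rnorm x = P `^ k%:~R.
Proof.
rewrite /psphere/rnorm/= => ->.
by rewrite powR_intmul ?ltW// fmorphXz /= ratr_nat.
Qed.

Lemma integral_psphere k (g : Qp hp -> R) (c : R) :
  (forall x, psphere hp k x -> g x = c) ->
  (\int[mu]_(x in psphere hp k) (g x)%:E = (c * (P `^ k%:~R * (1 - P^-1)))%:E)%E.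
Proof.
move=> gc; rewrite (eq_integral (cst c%:E)); last first.
  by move=> x /set_mem/gc ->.
rewrite integral_cst; last exact: measurable_psphere.
by rewrite haar_psphere EFinM powR_intmul// ltW.
Qed.

End HaarBalls.

Definition hlp_const (R : realType) (P s : R) : R :=
  (1 - 1 / P) * (1 / (1 - P `^ (s - 1)) + P `^ (- s) / (1 - P `^ (- s))).

Definition hlp_const_trunc (R : realType) (P s : R) (m : nat) : R :=
  (1 - P^-1) * (\sum_(0 <= n < m) (P `^ (s - 1)) ^+ n +
                P `^ (- s) * \sum_(0 <= n < m) (P `^ (- s)) ^+ n).

Section HlpConst.
Context (R : realType) (P s : R).
Hypotheses (P1 : 1 < P) (s0 : 0 < s) (s1 : s < 1).

Lemma powR_lt1 r : r < 0 -> P `^ r < 1.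
Proof.
move=> r0; rewrite lt_neqAle powR_eq1 !negb_or (gt_eqF P1) (lt_eqF r0) /=.
rewrite -leNgt (ltW (lt_trans ltr01 P1)) -[leRHS](powRr0 P).
by rewrite ler_powR ?ltW.
Qed.

Let s10 : s - 1 < 0. Proof. by rewrite subr_lt0. Qed.
Let sN0 : - s < 0. Proof. by rewrite oppr_lt0. Qed.

Lemma hlp_const_sym : hlp_const P (1 - s) = hlp_const P s.
Proof.
rewrite /hlp_const addrAC subrr add0r opprB; congr (_ * _).
have := powR_lt1 s10; have := powR_lt1 sN0.
set a := _ `^ _; set b := _ `^ _ => a1 b1.
by field; rewrite !subr_eq0 !gt_eqF.
Qed.

Lemma hlp_const_gt0 : 0 < hlp_const P s.
Proof.
have := powR_lt1 s10; have := powR_lt1 sN0; rewrite /hlp_const => a1 b1.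
have P0 : 0 < P := lt_trans ltr01 P1.
apply: mulr_gt0; first by rewrite subr_gt0 div1r invf_lt1.
by apply: addr_gt0; apply: divr_gt0; rewrite ?ltr01 ?powR_gt0 ?subr_gt0.
Qed.

Lemma hlp_const_trunc_ge0 m : 0 <= hlp_const_trunc P s m.
Proof.
have P0 : 0 < P := lt_trans ltr01 P1.
apply: mulr_ge0; first by rewrite subr_ge0 invf_le1 // ltW.
by apply: addr_ge0; rewrite ?mulr_ge0 ?powR_ge0//;
  apply: sumr_ge0 => n _; rewrite exprn_ge0 ?powR_ge0.
Qed.

Lemma cvg_hlp_const_trunc :
  hlp_const_trunc P s m @[m --> \oo] --> hlp_const P s.
Proof.
have G r : r < 0 ->
    \sum_(0 <= n < m) (P `^ r) ^+ n @[m --> \oo] --> 1 / (1 - P `^ r).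
  move=> r0; rewrite (_ : (fun m => _) = series (geometric 1 (P `^ r))).
    by apply: cvg_geometric_series; rewrite ger0_norm ?powR_ge0 ?powR_lt1.
  by apply/funext => m; rewrite /series /=; apply: eq_bigr => n _; rewrite mul1r.
rewrite /hlp_const div1r -[P `^ (- s) / _](mul1r) mulrCA.
apply: cvgMr; apply: cvgD; first exact: G.
by apply: cvgMr; exact: G.
Qed.

End HlpConst.

(* The two halves produce the two geometric sums of [hlp_const_trunc]. *)
Definition window (j : int) (m : nat) : seq int :=
  [seq j - n%:Z | n <- iota 0 m] ++ [seq j + n.+1%:Z | n <- iota 0 m].

Lemma mem_window j m k : (k \in window j m) = (j - m%:Z < k <= j + m%:Z).
Proof.
rewrite mem_cat; apply/orP/idP => [[] /mapP[n]|/andP[jk kj]].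
- by rewrite mem_iota /= add0n => nm ->; lia.
- by rewrite mem_iota /= add0n => nm ->; lia.
- have [kj'|jk'] := leP k j; [left|right]; apply/mapP.
    by exists `|j - k|%N; rewrite ?mem_iota; lia.
  by exists (`|k - j|.-1)%N; rewrite ?mem_iota; lia.
Qed.

Lemma uniq_window j m : uniq (window j m).
Proof.
rewrite cat_uniq !map_inj_uniq ?iota_uniq//=; try by move=> a b; lia.
rewrite andbT; apply/hasPn => k /mapP[n _ ->]; apply/mapP => -[l _].
by lia.
Qed.

Section PadicShells.
Context (p : nat) (hp : prime p).

Definition pspheres (s : seq int) : set (Qp hp) :=
  \big[setU/set0]_(k <- s) psphere hp k.

Lemma pspheresP s x : pspheres s x <-> exists2 k, k \in s & psphere hp k x.
Proof. by rewrite /pspheres -bigcup_seq; split => -[k ks kx]; exists k. Qed.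

Lemma measurable_pspheres s : measurable (pspheres s).
Proof. by apply: bigsetU_measurable => k _; exact: measurable_psphere. Qed.

Lemma psphere_inj k l (x : Qp hp) : psphere hp k x -> psphere hp l x -> k = l.
Proof.
rewrite /psphere /= => -> /ieexprIz; apply.
  by rewrite ltr0n prime_gt0.
by rewrite gt_eqF// ltr1n prime_gt1.
Qed.

Lemma bigcup_window j : \bigcup_m pspheres (window j m) = [set x : Qp hp | x != 0].
Proof.
apply/seteqP; split => x /=.
  move=> [m _ /pspheresP[k _]]; rewrite /psphere -padic_norm_eq0 /= => ->.
  by rewrite expfz_neq0// pnatr_eq0 -lt0n prime_gt0.
move=> /padic_norm_pow[k xk]; exists `|k - j|.+1%N => //; apply/pspheresP.
by exists k => //; rewrite mem_window; lia.
Qed.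

End PadicShells.

Arguments pspheres {p} hp s _.

Section RadialIntegral.
Context (R : realType) (p : nat) (hp : prime p).
Context (mu : {measure set (Qp hp) -> \bar R}) (hmu : padic_haar mu).
Local Notation N := (@rnorm R p hp).

Let P : R := p%:R.
Let P_gt1 : 1 < P. Proof. by rewrite ltr1n prime_gt1. Qed.
Let P_gt0 : 0 < P. Proof. exact: lt_trans P_gt1. Qed.

Lemma measurable_fun_rnorm d (U : measurableType d) (D : set (Qp hp))
  (phi : R -> U) : measurable_fun D (fun x => phi (N x)).
Proof. by apply: measurable_fun_radial => x y; rewrite /rnorm => ->. Qed.

Lemma integral_pspheres (s : seq int) (phi : R -> R) :
  (forall r, 0 <= phi r) -> uniq s ->
  (\int[mu]_(x in pspheres hp s) (phi (N x))%:E =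
   (\sum_(k <- s) phi (P `^ k%:~R) * (P `^ k%:~R * (1 - P^-1)))%:E)%E.
Proof.
move=> phi0 us; rewrite ge0_integral_bigsetU//.
- rewrite -sumEFin; apply: eq_bigr => k _.
  by apply: integral_psphere => // x /(rnorm_psphere R) ->.
- exact: measurable_psphere.
- apply/trivIsetP => k l _ _ kl; rewrite -subset0 => x [xk xl].
  by move/negP: kl; apply; apply/eqP; exact: psphere_inj xk xl.
- exact: (measurable_fun_rnorm (fun r => (phi r)%:E)).
- by move=> x _; rewrite lee_fin.
Qed.

Lemma integral_window s x j m : psphere hp j x ->
  (\int[mu]_(y in pspheres hp (window j m)) (N y `^ (- s) / Num.max (N x) (N y))%:E =
   (hlp_const_trunc P s m * N x `^ (- s))%:E)%E.
Proof.
move=> xj; rewrite (rnorm_psphere R xj).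
rewrite (@integral_pspheres (window j m) (fun r => r `^ (- s) / Num.max (P `^ j%:~R) r));
  last 2 first.
- move=> r; apply: divr_ge0; rewrite ?powR_ge0// le_max powR_ge0//.
- exact: uniq_window.
congr EFin; rewrite big_cat /= !big_map /hlp_const_trunc; move: (1 - P^-1) => c.
have pow (a b : R) : P `^ (a + b) = P `^ a * P `^ b.
  by rewrite powRD// (gt_eqF P_gt0) implybT.
have pown (a : R) n : (P `^ a) ^+ n = P `^ (a * n%:R).
  by rewrite powRrM powR_mulrn// powR_ge0.
have ac (u v w : R) : u * v * (w * c) = c * (u * v * w) by ring.
rewrite -[RHS]mulrA mulrDl mulrDr /index_iota subn0; congr (_ + _).
  rewrite mulr_suml mulr_sumr; apply: eq_bigr => n _.
  rewrite max_l ?ler_powR ?(ltW P_gt1)//; last by rewrite ler_int; lia.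
  rewrite ac -powRN -!powRrM pown -!pow; congr (_ * P `^ _).
  by rewrite intrD mulrNz; ring.
rewrite mulr_sumr mulr_suml mulr_sumr; apply: eq_bigr => n _.
rewrite max_r ?ler_powR ?(ltW P_gt1)//; last by rewrite ler_int; lia.
rewrite ac -powRN -!powRrM pown -!pow; congr (_ * P `^ _).
by rewrite intrD -addn1 PoszD intrD; ring.
Qed.

Lemma integral_neq0 (f : Qp hp -> \bar R) :
  measurable_fun setT f -> (forall x, 0 <= f x)%E ->
  (\int[mu]_(x in [set x | x != 0%R]) f x = \int[mu]_x f x)%E.
Proof.
move=> mf f0.
rewrite [RHS](@ge0_negligible_integral _ _ _ mu _ [set 0%R : Qp hp])//;
  [|exact: measurable_set1_0|exact: haar_set1_0].
by congr integral; apply/seteqP; split => x /=; [move/eqP|move=> [_ /eqP]].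
Qed.

(* At [y = 0] the integrand vanishes, since [0 `^ r = 0] for [r != 0]. *)
Lemma integral_hlp_kernel s x : 0 < s -> s < 1 -> x != 0 ->
  (\int[mu]_y (N y `^ (- s) / Num.max (N x) (N y))%:E =
   (hlp_const P s * N x `^ (- s))%:E)%E.
Proof.
move=> s0 s1 x0; have [j xj] := padic_norm_pow x0.
have mf D : measurable_fun D (fun y => (N y `^ (- s) / Num.max (N x) (N y))%:E).
  exact: (measurable_fun_rnorm (fun r => (r `^ (- s) / Num.max (N x) r)%:E)).
have f0 y : (0 <= (N y `^ (- s) / Num.max (N x) (N y))%:E)%E.
  by rewrite lee_fin divr_ge0 ?powR_ge0// le_max rnorm_ge0.
rewrite -integral_neq0// -(bigcup_window hp j).
pose g y := (N y `^ (- s) / Num.max (N x) (N y))%:E.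
have H1 : (\int[mu]_(y in pspheres hp (window j m)) g y)%E @[m --> \oo] -->
    (\int[mu]_(y in \bigcup_m pspheres hp (window j m)) g y)%E.
  apply: ge0_nondecreasing_set_cvg_integral => //.
  - move=> m n mn; apply/subsetPset => y /pspheresP[k ks ky]; apply/pspheresP.
    by exists k => //; move: ks; rewrite !mem_window; lia.
  - by move=> i; exact: measurable_pspheres.
  - by move=> i y _; exact: f0.
apply: (cvg_unique (@ereal_hausdorff R) H1).
rewrite (_ : (fun m => _) =
    EFin \o (fun m => hlp_const_trunc P s m * N x `^ (- s))); last first.
  by apply/funext => m; rewrite /= integral_window.
apply/cvg_EFin; first exact: nearW.
by apply: cvgMl; exact: cvg_hlp_const_trunc.
Qed.

End RadialIntegral.

Lemma le_poweR (R : realType) (x y : \bar R) (r : R) : 0 <= r ->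
  (0 <= x)%E -> (x <= y)%E -> (x `^ r <= y `^ r)%E.
Proof.
move=> r0 x0 xy; apply: gt0_ler_poweR => //; rewrite in_itv/= leey andbT//.
exact: le_trans xy.
Qed.

Section UpperBound.
Context (R : realType) (p : nat) (hp : prime p).
Context (mu : {measure set (Qp hp) -> \bar R}) (hmu : padic_haar mu).
Local Notation N := (@rnorm R p hp).
Local Notation D0 := [set y : Qp hp | y != 0].

Let P : R := p%:R.
Let P_gt1 : 1 < P. Proof. by rewrite ltr1n prime_gt1. Qed.

Context (q s : R).
Hypotheses (q1 : 1 < q) (s0 : 0 < s) (s1 : s < 1).
Let q0 : 0 < q. Proof. exact: lt_trans q1. Qed.
Let C := hlp_const P s.
Let C0 : 0 < C. Proof. exact: hlp_const_gt0. Qed.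

Context (f : Qp hp -> R) (mf : measurable_fun setT f).

Let maxN_ge0 x y : 0 <= Num.max (N x) (N y).
Proof. by rewrite le_max rnorm_ge0. Qed.

Lemma measurable_neq0 : measurable D0.
Proof.
apply: measurable_radial => x y xy /=.
by rewrite -!padic_norm_eq0 xy.
Qed.

Lemma measurable_padic_hlp : measurable_fun setT (padic_hlp mu f).
Proof. by apply: measurable_fun_radial => x y xy; rewrite /padic_hlp xy. Qed.

Lemma measurable_hlp_integrand (g : Qp hp -> R) x : measurable_fun setT g ->
  measurable_fun setT (fun y => (g y / Num.max (N x) (N y))%:E).
Proof.
move=> mg; apply/measurable_EFinP; apply: measurable_funM => //.
exact: (measurable_fun_rnorm (fun r => (Num.max (N x) r)^-1)).
Qed.

Let nf : measurable_fun setT (fun y => `|f y|).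
Proof. exact: measurableT_comp. Qed.

Lemma abse_padic_hlp_le x :
  (`|padic_hlp mu f x| <= \int[mu]_(y in D0) (`|f y| / Num.max (N x) (N y))%:E)%E.
Proof.
apply: le_trans (le_abse_integral _ _ _) _.
- exact: measurable_neq0.
- exact: measurable_funTS (measurable_hlp_integrand x mf).
- rewrite le_eqVlt; apply/orP; left; apply/eqP; apply: eq_integral => y _ /=.
  by rewrite normrM normfV (ger0_norm (maxN_ge0 x y)).
Qed.

Lemma padic_hlp_hoelder x : x != 0 ->
  ((\int[mu]_(y in D0) (`|f y| / Num.max (N x) (N y))%:E) `^ q <=
   (\int[mu]_y (`|f y| `^ q * N y `^ (s * (q - 1)) / Num.max (N x) (N y))%:E) *
   ((C * N x `^ (- s)) `^ (q - 1))%:E)%E.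
Proof.
move=> x0; pose t := s * (q - 1) / q; pose q' := q / (q - 1).
have qB0 : 0 < q - 1 by rewrite subr_gt0.
have q'0 : 0 < q' by rewrite divr_gt0.
have t0 : t != 0 by rewrite gt_eqF// divr_gt0// mulr_gt0.
(* [v 0 = 0], so the product [u * v] is the integrand on [D0] and [0] at [0]. *)
pose K y := (Num.max (N x) (N y))^-1.
have K0 y : 0 <= K y by rewrite invr_ge0.
pose u y := `|f y| * (K y `^ q^-1 * N y `^ t).
pose v y := K y `^ q'^-1 * N y `^ (- t).
have mf_u : measurable_fun setT u.
  apply: measurable_funM => //.
  exact: (measurable_fun_rnorm (fun r => (Num.max (N x) r)^-1 `^ q^-1 * r `^ t)).
have mf_v : measurable_fun setT v.
  exact: (measurable_fun_rnorm (fun r => (Num.max (N x) r)^-1 `^ q'^-1 * r `^ (- t))).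
have qq' : q^-1 + q'^-1 = 1 by rewrite /q'; field; rewrite !gt_eqF.
have u0 y : 0 <= u y by rewrite !mulr_ge0 ?powR_ge0.
have v0 y : 0 <= v y by rewrite !mulr_ge0 ?powR_ge0.
have := hoelder mu mf_u mf_v q0 q'0 qq'.
rewrite Lnorm1.
have -> : (\int[mu]_y `|(EFin \o (u \* v)%R) y| =
    \int[mu]_(y in D0) (`|f y| / Num.max (N x) (N y))%:E)%E.
  rewrite -integral_neq0//; last first.
    by do 2 apply: measurableT_comp => //; exact: measurable_funM.
  apply: eq_integral => y; rewrite inE /= => y0.
  rewrite ger0_norm; last exact: mulr_ge0.
  apply/eqP; rewrite eqe /u /v -mulrA [X in _ * X]mulrACA -powRD ?qq' ?oner_eq0//.
  rewrite powRr1//; apply/eqP.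
  have -> : `|f y| * (K y * (N y `^ t * N y `^ (- t))) =
      `|f y| * K y * (N y `^ t * N y `^ (- t)) by ring.
  by rewrite powRN divff ?mulr1// gt_eqF// powR_gt0// rnorm_gt0.
move=> /(le_poweR (ltW q0) _) => /(_ _)/le_trans; apply.
  by apply: integral_ge0 => y _; rewrite lee_fin divr_ge0.
rewrite poweRM ?Lnorm_ge0// poweR_Lnorm ?gt_eqF//.
rewrite le_eqVlt; apply/orP; left; apply/eqP; congr (_ * _)%E.
  apply: eq_integral => y _; rewrite /= ger0_norm// /u.
  rewrite powRM//; last by rewrite mulr_ge0// powR_ge0.
  rewrite powRM ?powR_ge0// -!powRrM mulVf ?gt_eqF// powRr1//.
  by rewrite /t mulfVK ?gt_eqF// mulrAC mulrA.
rewrite -{1}(_ : q' * (q - 1) = q); last by rewrite /q' mulfVK// gt_eqF.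
rewrite poweRrM poweR_Lnorm ?gt_eqF// -poweR_EFin; congr (_ `^ _)%E.
rewrite -(integral_hlp_kernel hmu s0 s1 x0).
apply: eq_integral => y _; rewrite /= ger0_norm// /v.
rewrite powRM ?powR_ge0// -!powRrM mulVf ?gt_eqF// powRr1// mulrC.
congr (_ `^ _ * _)%:E; rewrite /t /q'; field.
by rewrite !gt_eqF.
Qed.

Lemma integral_hlp_kernel_sym y : y != 0 ->
  (\int[mu]_x (N x `^ (s - 1) / Num.max (N x) (N y))%:E =
   (C * N y `^ (s - 1))%:E)%E.
Proof.
move=> y0; have s10 : 0 < 1 - s by rewrite subr_gt0.
have s11 : 1 - s < 1 by rewrite ltrBlDr ltrDl.
rewrite /C -hlp_const_sym// -[s - 1]opprB -(integral_hlp_kernel hmu s10 s11 y0).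
by apply: eq_integral => x _; rewrite maxC.
Qed.

Lemma integral_padic_hlp_le :
  (\int[mu]_x (`|padic_hlp mu f x| `^ q * (N x `^ (s * q - 1))%:E) <=
   (C `^ q)%:E * \int[mu]_x (`|f x| `^ q * N x `^ (s * q - 1))%:E)%E.
Proof.
have sf := haar_sigma_finite hmu.
(* Tonelli's theorem asks for [mu] packaged as a sigma-finite measure. *)
pose H1 := isSFinite.Build _ _ _ _ (sfinite_measure_sigma_finite sf).
pose H2 := isSigmaFinite.Build _ _ _ _ sf.
pose mu' := HB.pack_for (SigmaFiniteMeasure.type (Qp hp) R) (Measure.sort mu) H1 H2.
have qB0 : 0 < q - 1 by rewrite subr_gt0.
have sq0 : s * (q - 1) != 0 by rewrite gt_eqF// mulr_gt0.
pose w y := `|f y| `^ q * N y `^ (s * (q - 1)).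
have w0 y : 0 <= w y by rewrite mulr_ge0 ?powR_ge0.
pose k x y := N x `^ (s - 1) / Num.max (N x) (N y).
have k0 x y : 0 <= k x y by rewrite divr_ge0// powR_ge0.
pose D := C `^ (q - 1).
have D_ge0 : 0 <= D by exact: powR_ge0.
pose G (z : Qp hp * Qp hp) : \bar R := (D * (k z.1 z.2 * w z.2))%:E.
have mN : measurable_fun setT N by exact: (measurable_fun_rnorm id).
have mw : measurable_fun setT w.
  apply: measurable_funM; last exact: (measurable_fun_rnorm (fun r => r `^ _)).
  exact: (measurableT_comp (measurable_powR q) nf).
have mG : measurable_fun setT G.
  apply/measurable_EFinP; apply: measurable_funM => //; apply: measurable_funM.
    have mN1 := measurableT_comp mN (@measurable_fst _ _ (Qp hp) (Qp hp)).
    have mN2 := measurableT_comp mN (@measurable_snd _ _ (Qp hp) (Qp hp)).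
    apply: measurable_funM; first exact: measurableT_comp (measurable_powR _) mN1.
    rewrite (_ : (fun z => _) = fun z => Num.max (N z.1) (N z.2) `^ (-1)).
      by apply: (measurableT_comp (measurable_powR _)); exact: measurable_maxr.
    by apply/funext => z; rewrite powR_inv1.
  exact: measurableT_comp.
have G0 z : (0 <= G z)%E.
  by rewrite lee_fin; apply: mulr_ge0 => //; exact: mulr_ge0.
rewrite -integral_neq0//; last 2 first.
  apply: emeasurable_funM.
    apply: (measurableT_comp (measurable_poweR q)).
    by apply: measurableT_comp => //; exact: measurable_padic_hlp.
  exact: (measurable_fun_rnorm (fun r => (r `^ _)%:E)).
  by move=> x; rewrite mule_ge0 ?poweR_ge0// lee_fin powR_ge0.
apply: (@le_trans _ _ (\int[mu]_(x in D0) \int[mu]_y G (x, y))%E).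
  apply: ge0_le_integral; first exact: measurable_neq0.
  - by move=> x _; rewrite mule_ge0 ?poweR_ge0// lee_fin powR_ge0.
  - apply: emeasurable_funM.
      apply: (measurableT_comp (measurable_poweR q)).
      apply: measurableT_comp => //.
      exact: measurable_funTS measurable_padic_hlp.
    exact: (measurable_fun_rnorm (fun r => (r `^ _)%:E)).
  - by apply: measurable_fun_radial => x y xy; rewrite /G /k /rnorm /= xy.
  move=> x /= x0.
  have Nx0 : 0 < N x by rewrite rnorm_gt0.
  apply: (@le_trans _ _
      (\int[mu]_y (`|f y| `^ q * N y `^ (s * (q - 1)) / Num.max (N x) (N y))%:E *
       ((C * N x `^ (- s)) `^ (q - 1) * N x `^ (s * q - 1))%:E)%E).
    rewrite EFinM muleA; apply: lee_wpmul2r; first by rewrite lee_fin powR_ge0.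
    apply: le_trans (padic_hlp_hoelder x0); apply: le_poweR => //; first exact: ltW.
    exact: abse_padic_hlp_le.
  rewrite muleC -ge0_integralZl//; last 3 first.
  + apply/measurable_EFinP; apply: measurable_funM => //.
    exact: (measurable_fun_rnorm (fun r => (Num.max (N x) r)^-1)).
  + by move=> y _; rewrite lee_fin; apply: divr_ge0 => //; exact: w0.
  + by rewrite lee_fin mulr_ge0// powR_ge0.
  rewrite le_eqVlt; apply/orP; left; apply/eqP; apply: eq_integral => y _.
  have E : (C * N x `^ (- s)) `^ (q - 1) * N x `^ (s * q - 1) = D * N x `^ (s - 1).
    rewrite powRM ?powR_ge0 ?(ltW C0)// -mulrA; congr (_ * _).
    rewrite -powRrM -powRD; last by rewrite (gt_eqF Nx0) implybT.
    by congr (_ `^ _); ring.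
  have rearr (a b c d e : R) : a * b * (c * d / e) = a * (b / e * (c * d)) by ring.
  by rewrite E -EFinM rearr.
rewrite integral_neq0//; last 2 first.
  by apply: measurable_fun_radial => x y xy; rewrite /G /k /rnorm /= xy.
  by move=> x; exact: integral_ge0.
rewrite -[X in (X <= _)%E]/(\int[mu']_x \int[mu']_y G (x, y))%E fubini_tonelli//.
rewrite -ge0_integralZl//; last 3 first.
- apply/measurable_EFinP; apply: measurable_funM.
    exact: (measurableT_comp (measurable_powR q) nf).
  exact: (measurable_fun_rnorm (fun r => r `^ _)).
- by move=> x _; rewrite lee_fin mulr_ge0 ?powR_ge0.
- by rewrite lee_fin powR_ge0.
apply: ge0_le_integral => //.
- by move=> y _; exact: integral_ge0.
- exact: (measurable_fun_fubini_tonelli_G (m1 := mu')).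
- apply: measurable_funeM; apply/measurable_EFinP; apply: measurable_funM.
    exact: (measurableT_comp (measurable_powR q) nf).
  exact: (measurable_fun_rnorm (fun r => r `^ _)).
move=> y _; have [->|y0] := eqVneq y 0.
  rewrite (eq_integral (cst 0)) ?integral0 -?EFinM ?lee_fin ?mulr_ge0 ?powR_ge0//.
  by move=> x _; rewrite /G /w /= rnorm0 powR0// !mulr0.
rewrite -[X in (X <= _)%E]/(\int[mu]_x G (x, y))%E.
rewrite (eq_integral (fun x => (D * w y)%:E * (k x y)%:E)%E); last first.
  by move=> x _; rewrite /G /= -EFinM; congr EFin; ring.
rewrite ge0_integralZl//; last 3 first.
- exact: (measurable_fun_rnorm (fun r => (r `^ _ / Num.max r (N y))%:E)).
- by move=> x _; rewrite lee_fin.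
- by rewrite lee_fin mulr_ge0.
rewrite integral_hlp_kernel_sym// -!EFinM lee_fin /D /w.
rewrite le_eqVlt; apply/orP; left; apply/eqP.
have -> : C `^ q = C `^ (q - 1) * C.
  by rewrite mulrC mulr_powRB1// ltW.
have -> : N y `^ (s * q - 1) = N y `^ (s * (q - 1)) * N y `^ (s - 1).
  have Ny0 : 0 < N y by rewrite rnorm_gt0.
  rewrite -powRD; last by rewrite (gt_eqF Ny0) implybT.
  by congr (_ `^ _); ring.
by ring.
Qed.

End UpperBound.

Section OperatorNorm.
Context (R : realType) (p : nat) (hp : prime p).
Context (mu : {measure set (Qp hp) -> \bar R}) (hmu : padic_haar mu).
Local Notation N := (@rnorm R p hp).

Let P : R := p%:R.
Let P_gt1 : 1 < P. Proof. by rewrite ltr1n prime_gt1. Qed.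
Let P_gt0 : 0 < P. Proof. exact: lt_trans P_gt1. Qed.

Context (q s : R).
Hypotheses (q1 : 1 < q) (s0 : 0 < s) (s1 : s < 1).
Let q0 : 0 < q. Proof. exact: lt_trans q1. Qed.
Let alpha := s * q - 1.
Let C := hlp_const P s.
Let C0 : 0 < C. Proof. exact: hlp_const_gt0. Qed.

Lemma padic_hlp_bounded (f : Qp hp -> R) : padic_Lq mu q alpha (EFin \o f) ->
  padic_Lq mu q alpha (padic_hlp mu f) /\
  (padic_Lq_norm mu q alpha (padic_hlp mu f) <=
     C%:E * padic_Lq_norm mu q alpha (EFin \o f))%E.
Proof.
move=> [/measurable_EFinP mf fq].
have le : (padic_Lq_norm mu q alpha (padic_hlp mu f) <=
     C%:E * padic_Lq_norm mu q alpha (EFin \o f))%E.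
  have := integral_padic_hlp_le hmu q1 s0 s1 mf.
  move=> /(@le_poweR _ _ _ q^-1); rewrite invr_ge0 (ltW q0) => /(_ isT).
  rewrite integral_ge0; last first.
    by move=> x _; rewrite mule_ge0 ?poweR_ge0// lee_fin powR_ge0.
  move=> /(_ isT) /le_trans; apply.
  rewrite poweRM ?lee_fin ?powR_ge0//; last first.
    by apply: integral_ge0 => x _; rewrite lee_fin mulr_ge0 ?powR_ge0.
  by rewrite poweR_EFin -powRrM divff ?gt_eqF// powRr1 ?(ltW C0).
split=> //; split; first exact: measurable_padic_hlp.
by apply: le_lt_trans le _; rewrite lte_mul_pinfty // lee_fin ltW.
Qed.

Lemma integral_pspheres_weight (t : seq int) (b : R) : 0 <= b -> uniq t ->
  (\int[mu]_(x in pspheres hp t) ((b * N x `^ (- s)) `^ q * N x `^ alpha)%:E =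
   (b `^ q * ((size t)%:R * (1 - P^-1)))%:E)%E.
Proof.
move=> b0 ut; rewrite (@integral_pspheres _ _ _ _ hmu t
  (fun r => (b * r `^ (- s)) `^ q * r `^ alpha))//; last first.
  by move=> r; rewrite mulr_ge0 ?powR_ge0.
congr EFin; rewrite (eq_bigr (fun=> b `^ q * (1 - P^-1))).
  by rewrite big_const_seq count_predT iter_addr_0 -[LHS]mulr_natl mulrCA.
move=> k _; have Pk0 : 0 < P `^ k%:~R by rewrite powR_gt0.
rewrite powRM ?powR_ge0// -powRrM -!mulrA; congr (_ * _).
rewrite mulrA -powRD; last by rewrite (gt_eqF Pk0) implybT.
rewrite [X in _ `^ X](_ : _ = -1); last by rewrite /alpha; ring.
by rewrite powR_inv1 ?(ltW Pk0)// mulKf// gt_eqF.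
Qed.

Definition nat_shells (m n : nat) : seq int := [seq k%:Z | k <- iota m n].

Lemma uniq_nat_shells m n : uniq (nat_shells m n).
Proof. by rewrite map_inj_uniq ?iota_uniq// => a b []. Qed.

Lemma mem_nat_shells m n (k : int) :
  (k \in nat_shells m n) = (m%:Z <= k < (m + n)%:Z).
Proof.
apply/mapP/idP => [[l]|kmn]; first by rewrite mem_iota => ? ->; lia.
by exists `|k|%N; rewrite ?mem_iota; lia.
Qed.

Definition extremizer (a : R) (n : nat) : Qp hp -> R :=
  (fun y => a * N y `^ (- s)) \_ (pspheres hp (nat_shells 0 n)).

Lemma measurable_extremizer a n : measurable_fun setT (extremizer a n).
Proof.
apply/(measurable_restrictT _ (measurable_pspheres _)).
exact: (measurable_fun_rnorm (fun r => a * r `^ _)).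
Qed.

Lemma integral_extremizer a n : 0 <= a ->
  (\int[mu]_x (`|(EFin \o extremizer a n) x| `^ q *
     (ratr (padic_norm x) `^ alpha)%:E) = (a `^ q * (n%:R * (1 - P^-1)))%:E)%E.
Proof.
move=> a0; have := integral_pspheres_weight a0 (uniq_nat_shells 0 n).
rewrite size_map size_iota => <-; rewrite [RHS]integral_mkcond.
apply: eq_integral => x _; rewrite /extremizer /= !patchE -/(N x).
case: ifPn => _; first by rewrite ger0_norm ?mulr_ge0 ?powR_ge0.
by rewrite [X in `|X|](_ : _ = 0)// normr0 powR0 ?gt_eqF// mul0e.
Qed.

Lemma padic_hlp_extremizer_ge a n m j x : 0 <= a ->
  (m <= j)%N -> (j + m < n)%N -> psphere hp j x ->
  ((a * hlp_const_trunc P s m * N x `^ (- s))%:E <=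
   padic_hlp mu (extremizer a n) x)%E.
Proof.
move=> a0 mj jn xj.
have mmax D : measurable_fun D (fun y => (N y `^ (- s) / Num.max (N x) (N y))%:E).
  exact: (measurable_fun_rnorm (fun r => (r `^ (- s) / Num.max (N x) r)%:E)).
have g0 y : 0 <= extremizer a n y.
  by rewrite /extremizer patchE; case: ifPn => // _; rewrite mulr_ge0 ?powR_ge0.
have m0 y : 0 <= Num.max (N x) (N y) by rewrite le_max rnorm_ge0.
rewrite -mulrA EFinM -(integral_window hmu s m xj) -ge0_integralZl//; last 2 first.
- exact: measurable_pspheres.
- by move=> y _; rewrite lee_fin divr_ge0 ?powR_ge0.
rewrite (eq_integral (fun y => (extremizer a n y / Num.max (N x) (N y))%:E)).
  apply: ge0_subset_integral.
  - exact: measurable_pspheres.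
  - exact: measurable_neq0.
  - apply: measurable_funTS; apply: measurable_hlp_integrand.
    exact: measurable_extremizer.
  - by move=> y _; rewrite lee_fin divr_ge0.
  - by move=> y yw; rewrite -(bigcup_window hp j); exists m.
move=> y /set_mem/pspheresP[k]; rewrite mem_window => kw yk.
rewrite /extremizer patchE ifT -?EFinM ?mulrA//; apply/mem_set/pspheresP.
by exists k => //; rewrite mem_nat_shells; lia.
Qed.

Lemma hlp_opnorm_ge_trunc_pow m n : (2 * m <= n)%N -> (0 < n)%N ->
  ((hlp_const_trunc P s m `^ q * ((n - 2 * m)%:R / n%:R))%:E <=
    padic_Lq_opnorm mu q alpha (padic_hlp mu) `^ q)%E.
Proof.
move=> mn n0; set c := hlp_const_trunc P s m.
have c0 : 0 <= c by exact: hlp_const_trunc_ge0.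
have P10 : 0 < 1 - P^-1 by rewrite subr_gt0 invf_lt1.
have v0 : 0 < n%:R * (1 - P^-1) by rewrite mulr_gt0 ?ltr0n.
pose a := (n%:R * (1 - P^-1)) `^ (- q^-1).
have a0 : 0 <= a by exact: powR_ge0.
have aq : a `^ q * (n%:R * (1 - P^-1)) = 1.
  by rewrite -powRrM mulNr mulVf ?gt_eqF// powR_inv1 ?(ltW v0)// mulVf ?gt_eqF.
pose g := extremizer a n.
have gq : padic_Lq_norm mu q alpha (EFin \o g) = 1%E.
  by rewrite /padic_Lq_norm integral_extremizer// aq poweR1r.
have : (padic_Lq_norm mu q alpha (padic_hlp mu g) <=
    padic_Lq_opnorm mu q alpha (padic_hlp mu))%E.
  apply: ereal_sup_ubound; exists g => //; split; last by rewrite gq.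
  split; last by rewrite gq ltry.
  by apply/measurable_EFinP; exact: measurable_extremizer.
move=> /(le_poweR (ltW q0) (poweR_ge0 _ _)); apply: le_trans.
rewrite /padic_Lq_norm -poweRrM mulVf ?gt_eqF// poweRe1; last first.
  by apply: integral_ge0 => x _; rewrite mule_ge0 ?poweR_ge0// lee_fin powR_ge0.
have aV : n%:R^-1 = a `^ q * (1 - P^-1).
  have n0' : n%:R != 0 :> R by rewrite pnatr_eq0 -lt0n.
  by apply: (mulIf n0'); rewrite mulVf// -[LHS]aq; ring.
have E := @integral_pspheres_weight (nat_shells m (n - 2 * m)) (a * c)
  (mulr_ge0 a0 c0) (uniq_nat_shells _ _).
rewrite size_map size_iota in E.
apply: (@le_trans _ _ (\int[mu]_(x in pspheres hp (nat_shells m (n - 2 * m)))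
    ((a * c * N x `^ (- s)) `^ q * N x `^ alpha)%:E)%E).
  rewrite E lee_fin powRM// aV le_eqVlt; apply/orP; left; apply/eqP.
  by move: (a `^ q) (c `^ q) (1 - P^-1) (_%:R) => *; ring.
have mT D : measurable_fun D (fun x => (`|padic_hlp mu g x| `^ q *
    (ratr (padic_norm x) `^ alpha)%:E)%E).
  apply: emeasurable_funM.
    apply: (measurableT_comp (measurable_poweR q)).
    apply: measurableT_comp => //.
    exact: measurable_funTS (measurable_padic_hlp _ _).
  exact: (measurable_fun_rnorm (fun r => (r `^ _)%:E)).
have T0 x : (0 <= `|padic_hlp mu g x| `^ q *
    (ratr (padic_norm x) `^ alpha)%:E)%E.
  by rewrite mule_ge0 ?poweR_ge0// lee_fin powR_ge0.
pose t := nat_shells m (n - 2 * m).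
apply: (@le_trans _ _ (\int[mu]_(x in pspheres hp t) (`|padic_hlp mu g x| `^ q *
    (ratr (padic_norm x) `^ alpha)%:E))%E); last first.
  by apply: ge0_subset_integral => //; exact: measurable_pspheres.
apply: ge0_le_integral => //.
- exact: measurable_pspheres.
- by move=> x _; rewrite lee_fin mulr_ge0 ?powR_ge0.
- exact: (measurable_fun_rnorm (fun r => ((a * c * r `^ _) `^ q * r `^ _)%:E)).
move=> x /pspheresP[k]; rewrite mem_nat_shells => kn xk.
rewrite EFinM; apply: lee_wpmul2r; first by rewrite lee_fin powR_ge0.
rewrite -poweR_EFin; apply: le_poweR; first exact: ltW.
  by rewrite lee_fin mulr_ge0 ?powR_ge0// mulr_ge0.
have kE : k = `|k|%N :> int by lia.
rewrite kE in xk; apply: le_trans (lee_abs _).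
by apply: padic_hlp_extremizer_ge xk => //; lia.
Qed.

Lemma hlp_opnorm_ge_trunc m :
  ((hlp_const_trunc P s m)%:E <= padic_Lq_opnorm mu q alpha (padic_hlp mu))%E.
Proof.
have c0 : 0 <= hlp_const_trunc P s m by exact: hlp_const_trunc_ge0.
have S0 : (0 <= padic_Lq_opnorm mu q alpha (padic_hlp mu))%E.
  apply: (@le_trans _ _ (padic_Lq_norm mu q alpha (padic_hlp mu (extremizer 0 0)))).
    exact: poweR_ge0.
  apply: ereal_sup_ubound; exists (extremizer 0 0) => //.
  have n0 : padic_Lq_norm mu q alpha (EFin \o extremizer 0 0) = 0%E.
    rewrite /padic_Lq_norm integral_extremizer// mul0r mulr0.
    by rewrite poweR0r// invr_neq0// gt_eqF.
  split; last by rewrite n0.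
  split; last by rewrite n0.
  by apply/measurable_EFinP; exact: measurable_extremizer.
have := @hlp_opnorm_ge_trunc_pow m; move: S0.
case: (padic_Lq_opnorm _ _ _ _) => [r r0 H|_ _|//]; last by rewrite leey.
rewrite lee_fin in r0; rewrite lee_fin leNgt; apply/negP => rc.
have rcq : r `^ q < hlp_const_trunc P s m `^ q by apply: gt0_ltr_powR.
set c := hlp_const_trunc P s m `^ q in rcq H.
have d0 : 0 < c - r `^ q by rewrite subr_gt0.
pose n := (2 * m + (Num.truncn ((2 * m)%:R * c / (c - r `^ q))).+1)%N.
have mn : (2 * m <= n)%N by rewrite leq_addr.
have n0 : (0 < n)%N by rewrite /n addnS.
have n0' : 0 < n%:R :> R by rewrite ltr0n.
have := H n mn n0; rewrite poweR_EFin lee_fin mulrA ler_pdivrMr// natrB// leNgt.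
move=> /negP; apply.
have h : (2 * m)%:R * c / (c - r `^ q) < n%:R.
  apply: lt_le_trans (truncnS_gt _) _; rewrite ler_nat /n.
  exact: leq_addl.
rewrite ltr_pdivrMr// in h.
by move: h; set z := r `^ q; set w := (2 * m)%:R; set v := n%:R; lra.
Qed.

Lemma hlp_opnorm : padic_Lq_opnorm mu q alpha (padic_hlp mu) = C%:E.
Proof.
apply/eqP; rewrite eq_le; apply/andP; split.
  apply: ge_ereal_sup => _ [f [fq f1] <-].
  apply: le_trans (padic_hlp_bounded fq).2 _.
  by rewrite -[leRHS]mule1; apply: lee_wpmul2l => //; rewrite lee_fin ltW.
have := hlp_opnorm_ge_trunc.
case: (padic_Lq_opnorm _ _ _ _) => [r H|_|/(_ 0%N)//]; last by rewrite leey.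
have cv := cvg_hlp_const_trunc P_gt1 s0 s1.
rewrite lee_fin /C -(cvg_lim (@Rhausdorff R) cv); apply: limr_le.
  by apply/cvg_ex; eexists; exact: cv.
by apply: nearW => m; have := H m; rewrite lee_fin.
Qed.

End OperatorNorm.

Theorem theorem2p2 (R : realType) (p : nat) (hp : prime p)
    (mu : {measure set (Qp hp) -> \bar R}) (hmu : padic_haar mu)
    (q alpha : R) (hq : 1 < q) (halpha : -1 < alpha) (halphaq : alpha < q - 1) :
  let P : R := p%:R in
  let C : R := (1 - 1 / P) *
    (1 / (1 - P `^ ((alpha + 1) / q - 1)) +
     P `^ (- ((alpha + 1) / q)) / (1 - P `^ (- ((alpha + 1) / q)))) in
  (forall f : Qp hp -> R, padic_Lq mu q alpha (EFin \o f) ->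
     padic_Lq mu q alpha (padic_hlp mu f) /\
     (padic_Lq_norm mu q alpha (padic_hlp mu f) <=
        C%:E * padic_Lq_norm mu q alpha (EFin \o f))%E) /\
  padic_Lq_opnorm mu q alpha (padic_hlp mu) = C%:E.
Proof.
move=> P C; have q0 : 0 < q by exact: lt_trans hq.
have s0 : 0 < (alpha + 1) / q by rewrite divr_gt0// -ltrBlDr sub0r.
have s1 : (alpha + 1) / q < 1 by rewrite ltr_pdivrMr// mul1r -ltrBrDr.
have alphaE : alpha = (alpha + 1) / q * q - 1 by rewrite mulfVK ?gt_eqF// addrK.
have := conj (padic_hlp_bounded hmu hq s0 s1) (hlp_opnorm hmu hq s0 s1).
by rewrite -alphaE.
Qed.
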